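(* Let $\Phi = [\varphi_1,\dots,\varphi_m] \in \mathbb{C}^{n\times m}$ have full column rank, and let $x$ be a $k$-sparse $m$-dimensional vector (i.e. $x$ has at most $k$ non-zero entries) with support $S = \{ i : x_i \neq 0\}$. Let $\epsilon$ be an $n$-dimensional perturbation satisfying \[ \frac{\sigma_{\min}(\Phi)}{2}\, \min_{i \in S} |x_i| \;>\; \|\epsilon\|_2 , \] where $\sigma_{\min}(\Phi)$ denotes the smallest singular value of $\Phi$. Then Backward Regression and LACE (Least-Absolute Coefficient Elimination), each run with matrix $\Phi$, target $y = \Phi x + \epsilon$ and desired sparsity $k$, recover the support $S$ of $x$ in $m-k$ steps.
   Context: For an index set $A \subseteq \{1,\dots,m\}$, $\Phi_A$ is the submatrix of $\Phi$ consisting of the columns $\varphi_i$ with $i\in A$, and $\Phi_A^+$ is its Moore–Penrose pseudoinverse. The least-squares residual associated with $A$ and target $y\in\mathbb{C}^n$ is $r_A = (I - \Phi_A\Phi_A^+)y$, and the least-squares coefficient vector for $A$ is $x^{(A)} = \Phi_A^+ y$, with entries $x^{(A)}_i$ indexed by $i \in A$. Backward Regression with input $(\Phi, y, k)$: start with the active set $A = \{1,\dots,m\}$. While $|A| > k$, choose $i^* \in \arg\min_{i\in A} \| r_{A\setminus\{i\}}\|_2$ and replace $A$ by $A \setminus\{i^*\}$. Return $A$ as the support set. LACE with input $(\Phi, y, k)$: the same procedure, except that the deleted index is chosen as $i^* \in \arg\min_{i \in A} |x^{(A)}_i|$. Each deletion of one index counts as one step. An algorithm recovers the support $S$ when the support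 set it returns is $S$.
   Formalization: The returned set has k elements, so it cannot equal S when x has fewer than k non-zero entries; the formal theorem shows that S is contained in the returned set, with equality when |S| = k; for x = 0 no noise condition is imposed. *)

(* Defs.v *)
From mathcomp Require Import all_boot all_order all_algebra.
From mathcomp Require classical_sets.

Set Implicit Arguments.
Unset Strict Implicit.
Unset Printing Implicit Defensive.

Import Order.TTheory GRing.Theory Num.Theory.
Local Open Scope ring_scope.
Local Open Scope sesquilinear_scope.

(* Norms and singular values are computed in C itself: they are nonnegative
   real elements, on which the partial order of a numClosedFieldType is the
   usual order. *)

Section LinearAlgebra.
Variable C : numClosedFieldType.

Definition l2norm n (v : 'cV[C]_n) : C := sqrtC (\sum_i `|v i 0| ^+ 2).

(* Minimum of a sequence of real elements; 0 on the empty sequence. *)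
Definition seq_min (s : seq C) : C := \big[Num.min/head 0 s]_(t <- s) t.

(* Phi^* Phi is Hermitian, so its spectral_diag lists its eigenvalues with
   multiplicity.  This gives m singular values, the usual count when m <= n
   (in particular when Phi has full column rank). *)
Definition singular_values n m (Phi : 'M[C]_(n, m)) : seq C :=
  [seq sqrtC (spectral_diag (Phi ^t* *m Phi) 0 j) | j : 'I_m].

Definition sigma_min n m (Phi : 'M[C]_(n, m)) : C :=
  seq_min (singular_values Phi).

(* The four Penrose equations, which have exactly one solution. *)
Definition is_pseudoinverse n m (A : 'M[C]_(n, m)) (X : 'M[C]_(m, n)) : Prop :=
  [/\ A *m X *m A = A, X *m A *m X = X,
      (A *m X) ^t* = A *m X & (X *m A) ^t* = X *m A].

Definition pseudoinverse n m (A : 'M[C]_(n, m)) : 'M[C]_(m, n) :=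
  classical_sets.xget 0 (fun X => is_pseudoinverse A X).

Definition supp m (x : 'cV[C]_m) : {set 'I_m} := [set i | x i 0 != 0].

End LinearAlgebra.

Section LeastSquares.
Variables (C : numClosedFieldType) (n m : nat).
Variables (Phi : 'M[C]_(n, m)) (y : 'cV[C]_n).
Implicit Types A B : {set 'I_m}.

(* The j-th column is the column of Phi of index enum_val j, the j-th element
   of A. *)
Definition columns A : 'M[C]_(n, #|A|) :=
  colsub (fun j : 'I_#|A| => enum_val j) Phi.

Definition residual A : 'cV[C]_n :=
  (1%:M - columns A *m pseudoinverse (columns A)) *m y.

(* The entry of row j is the coefficient of index enum_val j. *)
Definition ls_coef A : 'cV[C]_#|A| := pseudoinverse (columns A) *m y.

(* The arg min need not be unique: one elimination step is a relation between
   the active sets before and after, allowing any choice of minimizer. *)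

Definition backward_step A B : Prop :=
  exists i, [/\ i \in A,
    forall j, j \in A -> l2norm (residual (A :\ i)) <= l2norm (residual (A :\ j))
    & B = A :\ i].

Definition lace_step A B : Prop :=
  exists2 i : 'I_#|A|,
    forall j : 'I_#|A|, `|ls_coef A i 0| <= `|ls_coef A j 0|
    & B = A :\ enum_val i.

End LeastSquares.

Section Elimination.
Variables (m : nat) (step : {set 'I_m} -> {set 'I_m} -> Prop) (k : nat).

(* run A t D: from active set A, the loop can return D after t deletions. *)
Inductive run : {set 'I_m} -> nat -> {set 'I_m} -> Prop :=
| run_stop (A : {set 'I_m}) : (#|A| <= k)%N -> run A 0 A
| run_step (A B : {set 'I_m}) t D : (k < #|A|)%N -> step A B -> run B t D -> run A t.+1 D.

(* Total correctness: the procedure can run to completion, and whatever the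
   choices of minimizers it takes t steps and returns a set satisfying P. *)
Definition outputs_in (t : nat) (P : {set 'I_m} -> Prop) : Prop :=
  (exists D, run setT t D) /\
  forall t' D, run setT t' D -> t' = t /\ P D.

End Elimination.

(* Main.v *)
(* Let S be the support of x and sigma = sigma_min Phi.  As long as the active
   set A strictly contains S, no step may delete an index of S.
   Backward Regression: for j in A \ S, x itself is a candidate for the least
   squares problem on A \ {j}, so that residual has norm at most |e|.  If the
   residual y - Phi z on A \ {i} with i in S were no larger, then
   |Phi (x - z)| <= 2 |e|, whereas (x - z)_i = x_i gives
   |Phi (x - z)| >= sigma |x_i| > 2 |e|.
   LACE: the coefficient vector z on A satisfies Phi (z - x) = P e with P the
   orthogonal projection onto the span of the active columns, hence
   sigma |z - x| <= |e| < sigma min_S |x_i| / 2, so z has modulus above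
   min_S |x_i| / 2 on S and below it on A \ S. *)
Require Import Defs.
From mathcomp Require Import all_boot all_order all_algebra.
From mathcomp Require Import reals complex.
From mathcomp Require Import ring.
From mathcomp Require classical_sets.

Set Implicit Arguments.
Unset Strict Implicit.
Unset Printing Implicit Defensive.

Import Order.TTheory GRing.Theory Num.Theory.
Local Open Scope ring_scope.
Local Open Scope sesquilinear_scope.

(** * Euclidean norm and orthogonal projections *)

Section LinearAlgebra.
Variable C : numClosedFieldType.
Implicit Types n m p : nat.

Lemma trmxC_mul n m p (A : 'M[C]_(n, m)) (B : 'M[C]_(m, p)) :
  (A *m B) ^t* = B ^t* *m A ^t*.
Proof. by rewrite trmx_mul map_mxM. Qed.

Lemma l2norm_ge0 n (v : 'cV[C]_n) : 0 <= l2norm v.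
Proof. by rewrite sqrtC_ge0 sumr_ge0 // => i _; rewrite exprn_ge0. Qed.

Lemma l2norm_sqr_sum n (v : 'cV[C]_n) : l2norm v ^+ 2 = \sum_i `|v i 0| ^+ 2.
Proof. exact: sqrtCK. Qed.

Lemma l2norm_sqr n (v : 'cV[C]_n) : l2norm v ^+ 2 = (v ^t* *m v) 0 0.
Proof.
rewrite l2norm_sqr_sum mxE; apply: eq_bigr => i _.
by rewrite !mxE normCK mulrC.
Qed.

Lemma ler_l2norm n p (u : 'cV[C]_n) (v : 'cV[C]_p) :
  (l2norm u <= l2norm v) = (l2norm u ^+ 2 <= l2norm v ^+ 2).
Proof. by rewrite ler_pXn2r // nnegrE l2norm_ge0. Qed.

Lemma norm_entry_le_l2norm n (v : 'cV[C]_n) i : `|v i 0| <= l2norm v.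
Proof.
rewrite -(@ler_pXn2r _ 2) ?nnegrE ?l2norm_ge0 // l2norm_sqr_sum (bigD1 i) //=.
by rewrite lerDl sumr_ge0 // => j _; rewrite exprn_ge0.
Qed.

Lemma l2norm_eq0 n (v : 'cV[C]_n) : l2norm v = 0 -> v = 0.
Proof.
move=> v0; apply/colP => i; rewrite mxE; apply/eqP; rewrite -normr_le0 -v0.
exact: norm_entry_le_l2norm.
Qed.

Lemma l2norm_subC n (u v : 'cV[C]_n) : l2norm (u - v) = l2norm (v - u).
Proof.
congr sqrtC; apply: eq_bigr => i _.
by rewrite !mxE distrC.
Qed.

(** By the parallelogram identity, |u - v|^2 <= 2 |u|^2 + 2 |v|^2 <= 4 |v|^2. *)
Lemma l2norm_sub_le2 n (u v : 'cV[C]_n) :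
  l2norm u <= l2norm v -> l2norm (u - v) <= l2norm v * 2.
Proof.
move=> le_uv; rewrite -(@ler_pXn2r _ 2) ?nnegrE ?mulr_ge0 ?l2norm_ge0 //.
have parallelogram : l2norm (u - v) ^+ 2 + l2norm (u + v) ^+ 2 =
    l2norm u ^+ 2 *+ 2 + l2norm v ^+ 2 *+ 2.
  rewrite !l2norm_sqr_sum -!sumrMnl -!big_split /=; apply: eq_bigr => i _.
  by rewrite !mxE !normCK rmorphB rmorphD /=; ring.
apply: le_trans (_ : l2norm u ^+ 2 *+ 2 + l2norm v ^+ 2 *+ 2 <= _).
  by rewrite -parallelogram lerDl exprn_ge0 // l2norm_ge0.
rewrite exprMn -natrX mulr_natr (mulrnDr _ 2 2) lerD2r lerMn2r /=.
by rewrite -ler_l2norm.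
Qed.

(* Pythagoras: [P v] and [v - P v] are orthogonal. *)
Lemma l2norm_proj_pythagoras n (P : 'M[C]_n) (v : 'cV[C]_n) :
  P ^t* = P -> P *m P = P ->
  l2norm v ^+ 2 = l2norm (P *m v) ^+ 2 + l2norm ((1%:M - P) *m v) ^+ 2.
Proof.
move=> Pherm Pidem.
set Q := 1%:M - P.
have Qherm : Q ^t* = Q.
  by apply/matrixP => i j; rewrite /Q -[in RHS]Pherm !mxE rmorphB /= rmorph_nat eq_sym.
have Qidem : Q *m Q = Q by rewrite mulmxBl mul1mx mulmxBr mulmx1 Pidem subrr subr0.
have gram_proj (T : 'M[C]_n) : T ^t* = T -> T *m T = T ->
    l2norm (T *m v) ^+ 2 = (v ^t* *m T *m v) 0 0.
  by move=> Therm Tidem; rewrite l2norm_sqr trmxC_mul Therm mulmxA -(mulmxA _ T T) Tidem.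
rewrite !gram_proj // l2norm_sqr -[in LHS](mulmx1 (v ^t*)) -(subrKC P 1%:M).
by rewrite mulmxDr mulmxDl mxE.
Qed.

Lemma l2norm_proj_le n (P : 'M[C]_n) (v : 'cV[C]_n) :
  P ^t* = P -> P *m P = P -> l2norm (P *m v) <= l2norm v.
Proof.
move=> Pherm Pidem; rewrite ler_l2norm (l2norm_proj_pythagoras v Pherm Pidem).
by rewrite lerDl exprn_ge0 // l2norm_ge0.
Qed.

Lemma l2norm_coproj_le n (P : 'M[C]_n) (v : 'cV[C]_n) :
  P ^t* = P -> P *m P = P -> l2norm ((1%:M - P) *m v) <= l2norm v.
Proof.
move=> Pherm Pidem; rewrite ler_l2norm (l2norm_proj_pythagoras v Pherm Pidem).
by rewrite lerDr exprn_ge0 // l2norm_ge0.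
Qed.

(** * Gram matrices and pseudoinverses of left-invertible matrices *)

Lemma gram_unitmx n m (A : 'M[C]_(n, m)) (L : 'M[C]_(m, n)) :
  L *m A = 1%:M -> A ^t* *m A \in unitmx.
Proof.
(* [kermx] is a left kernel, hence the transpose. A vector w killed by A^* A has |A w|^2 = w^* A^* A
   w = 0, and then w = L A w = 0. *)
move=> LA; rewrite -unitmx_tr -row_free_unit -kermx_eq0; apply/eqP/row_matrixP => i.
rewrite row0; set u := row i _.
have : u *m (A ^t* *m A)^T = 0 by rewrite /u -row_mul mulmx_ker row0.
move/(congr1 trmx); rewrite trmx_mul trmxK trmx0 => Gu.
have Au : A *m u^T = 0.
  apply/l2norm_eq0/eqP; rewrite -sqrf_eq0 l2norm_sqr trmxC_mul -mulmxA.
  by rewrite (mulmxA (A ^t*)) Gu mulmx0 mxE.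
by rewrite -[u]trmxK -[u^T]mul1mx -LA -mulmxA Au mulmx0 trmx0.
Qed.

(** [xget] returns a solution as soon as one exists; (A^* A)^-1 A^* is one. *)
Lemma pseudoinverseP n m (A : 'M[C]_(n, m)) (L : 'M[C]_(m, n)) :
  L *m A = 1%:M -> is_pseudoinverse A (pseudoinverse A).
Proof.
move=> LA; apply: (@classical_sets.xgetPex _ 0 (is_pseudoinverse A)).
have Gu := gram_unitmx LA; set G := A ^t* *m A in Gu.
have Gherm : G ^t* = G by rewrite /G trmxC_mul trmxCK.
have XA : invmx G *m A ^t* *m A = 1%:M by rewrite -mulmxA mulVmx.
exists (invmx G *m A ^t*); split.
- by rewrite -mulmxA XA mulmx1.
- by rewrite XA mul1mx.
- by rewrite !trmxC_mul trmxCK trmx_inv map_invmx Gherm !mulmxA.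
- by rewrite XA trmx1 map_mx1.
Qed.

Lemma pseudoinverseK n m (A : 'M[C]_(n, m)) (L : 'M[C]_(m, n)) :
  L *m A = 1%:M -> pseudoinverse A *m A = 1%:M.
Proof.
move=> LA; have [AXA _ _ _] := pseudoinverseP LA.
by rewrite -[LHS]mul1mx -LA -mulmxA (mulmxA A) AXA.
Qed.

(** * Smallest singular value *)

Lemma seq_min_nneg (s : seq C) : {in s, forall t, 0 <= t} ->
  0 <= seq_min s /\ {in s, forall t, seq_min s <= t}.
Proof.
rewrite /seq_min => s_ge0; have : 0 <= head 0 s.
  by case: s s_ge0 => //= a s; apply; rewrite mem_head.
(* The initial value of the fold is generalized to any nonnegative [h], since [head 0 s] would
   change along the induction. *)
move: (head 0 s) => h h_ge0.
elim: s s_ge0 => [|a s IHs] s_ge0; first by rewrite big_nil.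
have a_ge0 := s_ge0 a (mem_head _ _).
have [|b_ge0 b_le] := IHs _.
  by move=> t ts; apply: s_ge0; rewrite inE ts orbT.
rewrite big_cons; set b := \big[_/_]_(_ <- _) _ in b_ge0 b_le *.
(* The order of [C] is partial; nonnegative elements are real, hence comparable. *)
have cmp : a >=< b by rewrite real_comparable ?ger0_real.
split; first by rewrite comparable_le_min // a_ge0 b_ge0.
move=> t; rewrite comparable_ge_min // inE => /orP[/eqP->|ts].
  by rewrite lexx.
by rewrite b_le // orbT.
Qed.

(** With G = U^* D U and U unitary, |Phi v|^2 = v^* G v = (U v)^* D (U v). *)
Lemma gram_spectralE n m (Phi : 'M[C]_(n, m)) (v : 'cV[C]_m) :
  let G := Phi ^t* *m Phi in
  l2norm (Phi *m v) ^+ 2 =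
  \sum_j spectral_diag G 0 j * `|(spectralmx G *m v) j 0| ^+ 2.
Proof.
move=> G.
have Gnormal : G \is normalmx by apply/normalmxP; rewrite /G trmxC_mul trmxCK.
have Uu := spectral_unitarymx G.
rewrite l2norm_sqr trmxC_mul mulmxA -(mulmxA _ _ Phi) -/G.
rewrite {1}(orthomx_spectralP Gnormal) (invmx_unitary Uu) !mulmxA -trmxC_mul.
rewrite -mulmxA mxE; apply: eq_bigr => j _.
by rewrite mul_mx_diag !mxE mulrAC normCK mulrC (mulrC _ (_^*)).
Qed.

Lemma gram_spectral_diag_ge0 n m (Phi : 'M[C]_(n, m)) j :
  0 <= spectral_diag (Phi ^t* *m Phi) 0 j.
Proof.
set G := Phi ^t* *m Phi; set U := spectralmx G.
have UU : U *m U ^t* = 1%:M by apply/unitarymxP/spectral_unitarymx.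
(* U sends this vector to the j-th basis vector, so the sum collapses to the j-th eigenvalue, which
   is thus a squared norm. *)
have := gram_spectralE Phi (U ^t* *m delta_mx j 0).
rewrite /= -/G -/U (mulmxA U) UU mul1mx (bigD1 j) //= big1 => [|i /negbTE ij].
  by rewrite mxE !eqxx normr1 expr1n mulr1 addr0 => <-; rewrite exprn_ge0 ?l2norm_ge0.
by rewrite mxE ij normr0 expr0n mulr0.
Qed.

Lemma singular_values_ge0 n m (Phi : 'M[C]_(n, m)) :
  {in singular_values Phi, forall t, 0 <= t}.
Proof. by move=> _ /mapP[j _ ->]; rewrite sqrtC_ge0 gram_spectral_diag_ge0. Qed.

Lemma sigma_min_ge0 n m (Phi : 'M[C]_(n, m)) : 0 <= sigma_min Phi.
Proof. by have [] := seq_min_nneg (@singular_values_ge0 _ _ Phi). Qed.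

Lemma sigma_min_le n m (Phi : 'M[C]_(n, m)) (v : 'cV[C]_m) :
  sigma_min Phi * l2norm v <= l2norm (Phi *m v).
Proof.
have s0 := sigma_min_ge0 Phi.
have [_ s_le] := seq_min_nneg (@singular_values_ge0 _ _ Phi).
rewrite -(@ler_pXn2r _ 2) ?nnegrE ?mulr_ge0 ?l2norm_ge0 // exprMn gram_spectralE.
set G := Phi ^t* *m Phi; set U := spectralmx G.
(* U preserves the norm, so the two sums can be compared term by term. *)
have -> : l2norm v = l2norm (U *m v).
  apply/(@pexpIrn _ 2) => //; rewrite ?nnegrE ?l2norm_ge0 // !l2norm_sqr.
  rewrite trmxC_mul -mulmxA (mulmxA (U ^t*)) -invmx_unitary ?spectral_unitarymx //.
  by rewrite mulVmx ?mul1mx // spectral_unit.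
rewrite l2norm_sqr_sum mulr_sumr ler_sum // => j _.
rewrite ler_wpM2r ?exprn_ge0 // -[leRHS]sqrtCK ler_pXn2r ?nnegrE //.
  by apply/s_le/map_f; rewrite mem_enum.
by rewrite sqrtC_ge0 gram_spectral_diag_ge0.
Qed.

End LinearAlgebra.

(** * Runs of an elimination procedure whose steps never delete an index of [S] *)

Section Elimination.
Variables (m k : nat) (step : {set 'I_m} -> {set 'I_m} -> Prop) (S : {set 'I_m}).
Hypothesis step_total : forall A : {set 'I_m}, S \subset A -> (k < #|A|)%N ->
  exists B, step A B.
Hypothesis step_sound : forall A B : {set 'I_m}, S \subset A -> (k < #|A|)%N ->
  step A B -> exists2 i, i \in A :\: S & B = A :\ i.

Lemma step_invariant (A B : {set 'I_m}) : S \subset A -> (k < #|A|)%N -> step A B ->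
  S \subset B /\ #|A| = #|B|.+1.
Proof.
move=> SA kA AB; have [i iD ->] := step_sound SA kA AB.
move: iD; rewrite inE => /andP[iS iA].
by rewrite subsetD1 SA iS (cardsD1 i A) iA.
Qed.

Lemma run_total (A : {set 'I_m}) : S \subset A -> exists D, run step k A (#|A| - k) D.
Proof.
move sA: #|A| => s; elim: s A sA => [|s IHs] A sA SA.
  by exists A; apply: run_stop; rewrite sA.
have [leAk|kA] := leqP #|A| k.
  (* [#|A| <= k] unfolds to [#|A| - k == 0]: no deletion takes place. *)
  by exists A; rewrite -sA (eqP leAk); apply: run_stop.
have [B AB] := step_total SA kA; have [SB eqAB] := step_invariant SA kA AB.
have [|D BD] := IHs B _ SB; first by apply/succn_inj; rewrite -eqAB.
by exists D; rewrite subSn; [apply: run_step AB BD | rewrite -ltnS -sA].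
Qed.

Lemma run_sound (A D : {set 'I_m}) t : run step k A t D -> S \subset A ->
  [/\ t = (#|A| - k)%N, S \subset D & (#|D| <= k)%N].
Proof.
elim=> {A t D} [A leAk SA|A B t D kA AB _ IH SA]; first by rewrite (eqP leAk).
have [SB eqAB] := step_invariant SA kA AB; have [-> SD leD] := IH SB.
by rewrite eqAB subSn // -ltnS -eqAB.
Qed.

Lemma elimination_outputs_in :
  outputs_in step k (m - k) (fun D => S \subset D /\ (#|S| = k -> D = S)).
Proof.
split; first by have := run_total (subsetT S); rewrite cardsT card_ord.
move=> t D /run_sound /(_ (subsetT S)) []; rewrite cardsT card_ord => -> SD leDk.
do 2!split=> //; move=> eqSk; apply/esym/eqP.
by rewrite eqEcard SD eqSk.
Qed.

End Elimination.

(** Real values are totally ordered, so a minimizer exists despite the partial order of [C]. *)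
Lemma exists_real_argmin (C : numDomainType) (I : finType) (A : {set I}) (f : I -> C) :
  (forall i, f i \is Num.real) -> A != set0 ->
  exists2 i, i \in A & {in A, forall j, f i <= f j}.
Proof.
move=> f_real /set0Pn[i0 i0A].
case: (real_arg_minP i0A (fun i _ => f_real i)) => i iA imin.
by exists i.
Qed.

(** * Column submatrices and least squares *)

Section Columns.
Variables (C : numClosedFieldType) (n m : nat) (Phi : 'M[C]_(n, m)).
Implicit Type A : {set 'I_m}.

(* [columns 1%:M A] extends a vector indexed by [A] by zero. *)
Lemma columnsE A : columns Phi A = Phi *m columns 1%:M A.
Proof. by rewrite mulmx_colsub mulmx1. Qed.

Lemma extend_in A (z : 'cV[C]_#|A|) j : (columns 1%:M A *m z) (enum_val j) 0 = z j 0.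
Proof.
rewrite mxE (bigD1 j) //= big1 => [|i ij]; first by rewrite !mxE eqxx mul1r addr0.
by rewrite !mxE (inj_eq enum_val_inj) eq_sym (negbTE ij) mul0r.
Qed.

Lemma extend_out A (z : 'cV[C]_#|A|) i : i \notin A -> (columns 1%:M A *m z) i 0 = 0.
Proof.
move=> iA; rewrite mxE big1 // => j _; rewrite !mxE.
by case: eqP => [ij|_]; rewrite ?mul0r //; rewrite ij enum_valP in iA.
Qed.

Lemma extend_restrict A (x : 'cV[C]_m) : supp x \subset A ->
  columns 1%:M A *m rowsub enum_val x = x.
Proof.
move=> xA; apply/colP => i; have [iA|iA] := boolP (i \in A).
  by rewrite -(enum_rankK_in iA iA) extend_in mxE.
rewrite extend_out //; apply/esym/eqP/negPn; apply: contra iA => xi.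
by apply: (subsetP xA); rewrite inE.
Qed.

Hypothesis rkPhi : \rank Phi = m.

(** The rows indexed by [A] of a left inverse of [Phi] serve. *)
Lemma columns_left_inverse A : exists L, L *m columns Phi A = 1%:M.
Proof.
have /row_fullP[L LPhi] : row_full Phi by rewrite /row_full rkPhi.
exists ((columns 1%:M A)^T *m L).
rewrite columnsE mulmxA -(mulmxA _ L) LPhi mulmx1.
apply/matrixP => i j; rewrite mulmx_colsub mulmx1 !mxE.
by rewrite (inj_eq enum_val_inj) eq_sym.
Qed.

(** By the Penrose equations, [P] is the orthogonal projection onto the span of the active
    columns. *)
Lemma columns_projection A (P := columns Phi A *m pseudoinverse (columns Phi A)) :
  [/\ P ^t* = P, P *m P = P & P *m columns Phi A = columns Phi A].
Proof.
have [L LA] := columns_left_inverse A; have [AXA _ AX _] := pseudoinverseP LA.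
by split; rewrite // /P mulmxA AXA.
Qed.

(* The residual is the closest to [y]: it is [(1 - P) (y - Phi z)]. *)
Lemma residual_le (y : 'cV[C]_n) A (z : 'cV[C]_m) : supp z \subset A ->
  l2norm (residual Phi y A) <= l2norm (y - Phi *m z).
Proof.
move=> zA; have [Pherm Pidem PA] := columns_projection A.
have -> : residual Phi y A =
    (1%:M - columns Phi A *m pseudoinverse (columns Phi A)) *m (y - Phi *m z).
  rewrite mulmxBr -(extend_restrict zA) (mulmxA Phi) -columnsE.
  by rewrite (mulmxA (_ - _)) (_ : (_ - _) *m columns Phi A = 0)
    ?mul0mx ?subr0 // mulmxBl mul1mx PA subrr.
exact: l2norm_coproj_le.
Qed.

(** Writes the residual with a coefficient vector of full length, to which [sigma_min_le] applies
    after subtracting [x]. *)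
Lemma residual_eq (y : 'cV[C]_n) A :
  residual Phi y A = y - Phi *m (columns 1%:M A *m ls_coef Phi y A).
Proof. by rewrite /residual mulmxBl mul1mx mulmxA -columnsE mulmxA. Qed.

(* [Phi] maps the coefficient error to the projection of the noise. *)
Lemma ls_coef_error (x : 'cV[C]_m) (e : 'cV[C]_n) A : supp x \subset A ->
  l2norm (Phi *m (columns 1%:M A *m ls_coef Phi (Phi *m x + e) A - x)) <= l2norm e.
Proof.
move=> xA; have [Pherm Pidem PA] := columns_projection A.
suff -> : Phi *m (columns 1%:M A *m ls_coef Phi (Phi *m x + e) A - x) =
    columns Phi A *m pseudoinverse (columns Phi A) *m e by exact: l2norm_proj_le.
rewrite mulmxBr mulmxA -columnsE /ls_coef mulmxA mulmxDr.
have -> : Phi *m x = columns Phi A *m rowsub enum_val x.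
  by rewrite columnsE -mulmxA extend_restrict.
by rewrite (mulmxA _ (columns Phi A)) PA addrAC subrr add0r.
Qed.

End Columns.

(** * Both algorithms under small noise *)

Section Recovery.
Variables (C : numClosedFieldType) (n m k : nat).
Variables (Phi : 'M[C]_(n, m)) (x : 'cV[C]_m) (e : 'cV[C]_n).
Hypothesis rkPhi : \rank Phi = m.
Hypothesis xk : (#|supp x| <= k)%N.
Hypothesis small_noise : supp x != set0 ->
  l2norm e < sigma_min Phi / 2 * seq_min [seq `|x i 0| | i in supp x].
Let y := Phi *m x + e.
Let mu := seq_min [seq `|x i 0| | i in supp x].
Implicit Types A B : {set 'I_m}.

Let mu_le i : i \in supp x -> mu <= `|x i 0|.
Proof.
have [|_ le_mu] := @seq_min_nneg _ [seq `|x i 0| | i in supp x].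
  by move=> _ /mapP[j _ ->].
by move=> ix; apply/le_mu/map_f; rewrite mem_enum.
Qed.

Let noise_lt i : i \in supp x -> l2norm e * 2 < sigma_min Phi * mu.
Proof.
move=> ix; rewrite -ltr_pdivlMr // mulrAC; apply: small_noise.
by apply/set0Pn; exists i.
Qed.

(** Supplies the index off the support that competes with a wrongly deleted one. *)
Let setD_supp_neq0 A : (k < #|A|)%N -> A :\: supp x != set0.
Proof.
move=> kA; rewrite setD_eq0; apply: contraL kA => /subset_leq_card leA.
by rewrite -leqNgt (leq_trans leA).
Qed.

Let backward_total A : (k < #|A|)%N -> exists B, backward_step Phi y A B.
Proof.
move=> kA; have A0 : A != set0 by rewrite -card_gt0 (leq_trans _ kA).
pose f i := l2norm (residual Phi y (A :\ i)).
have [|i iA imin] := @exists_real_argmin _ _ A f _ A0.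
  by move=> i; rewrite ger0_real ?l2norm_ge0.
by exists (A :\ i), i.
Qed.

Let backward_sound A B : supp x \subset A -> (k < #|A|)%N ->
  backward_step Phi y A B -> exists2 i, i \in A :\: supp x & B = A :\ i.
Proof.
move=> xA kA [i [iA imin ->]]; exists i => //; rewrite inE iA andbT.
apply/negP => ix; have /set0Pn[j] := setD_supp_neq0 kA.
rewrite inE => /andP[jx jA].
have ri : l2norm (residual Phi y (A :\ i)) <= l2norm e.
  apply: le_trans (imin j jA) _.
  have -> : e = y - Phi *m x by rewrite /y addrAC subrr add0r.
  by apply: residual_le => //; rewrite subsetD1 xA.
set z := columns 1%:M (A :\ i) *m ls_coef Phi y (A :\ i).
have := l2norm_sub_le2 ri; rewrite residual_eq -/z.
have -> : y - Phi *m z - e = Phi *m (x - z).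
  by rewrite mulmxBr -addrA -opprD (addrC (_ *m z)) addrKA.
(* sigma |x - z| <= 2 |e| < sigma mu, which contradicts the bound mu <= |x - z| shown next. *)
move/(le_trans (sigma_min_le _ _))/le_lt_trans/(_ (noise_lt ix)).
have : mu <= l2norm (x - z).
  apply: le_trans (mu_le ix) (le_trans _ (norm_entry_le_l2norm _ i)).
  by rewrite 2!mxE /z extend_out ?subr0 // !inE eqxx.
move/(ler_wpM2l (sigma_min_ge0 Phi))/le_lt_trans => h /h.
by rewrite ltxx.
Qed.

Let lace_total A : (k < #|A|)%N -> exists B, lace_step Phi y A B.
Proof.
move=> kA; have A0 : [set: 'I_#|A|] != set0.
  by rewrite -card_gt0 cardsT card_ord (leq_trans _ kA).
pose f i := `|ls_coef Phi y A i 0|.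
have [|i _ imin] := @exists_real_argmin _ _ _ f _ A0.
  by move=> i; rewrite normr_real.
by exists (A :\ enum_val i), i => // j; apply: imin; rewrite inE.
Qed.

Let lace_sound A B : supp x \subset A -> (k < #|A|)%N ->
  lace_step Phi y A B -> exists2 i, i \in A :\: supp x & B = A :\ i.
Proof.
move=> xA kA [i imin ->]; exists (enum_val i) => //; rewrite inE enum_valP andbT.
apply/negP => ix; have /set0Pn[j] := setD_supp_neq0 kA.
rewrite inE => /andP[jx jA].
set z := columns 1%:M A *m ls_coef Phi y A.
have xj : x j 0 = 0 by apply/eqP; rewrite inE negbK in jx.
have zij : `|z (enum_val i) 0| <= `|z j 0|.
  by rewrite -(enum_rankK_in jA jA) /z !extend_in.
have zx : l2norm (z - x) * 2 < mu.
  (* If sigma were 0, the strict noise bound would read 2 |e| < 0. *)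
  have s_gt0 : 0 < sigma_min Phi.
    rewrite lt_def sigma_min_ge0 andbT; apply/eqP => s0.
    by have := noise_lt ix; rewrite s0 mul0r le_gtF ?mulr_ge0 ?l2norm_ge0.
  rewrite -(ltr_pM2l s_gt0) mulrA; apply: le_lt_trans (noise_lt ix).
  rewrite ler_pM2r //; apply: le_trans (sigma_min_le _ _) _.
  exact: ls_coef_error.
have zj : `|z j 0| <= l2norm (z - x).
  by rewrite -[z j 0]subr0 -xj; have := norm_entry_le_l2norm (z - x) j; rewrite !mxE.
have zi : `|x (enum_val i) 0 - z (enum_val i) 0| <= l2norm (z - x).
  rewrite l2norm_subC.
  by have := norm_entry_le_l2norm (x - z) (enum_val i); rewrite !mxE.
(* As x_j = 0 and |z_i| <= |z_j|, mu <= |x_i| <= |x_i - z_i| + |z_j| <= 2 |z - x|. *)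
suff : mu <= l2norm (z - x) * 2 by move/le_lt_trans/(_ zx); rewrite ltxx.
rewrite mulr_natr; apply: le_trans (mu_le ix) _.
rewrite -[x _ 0](subrK (z (enum_val i) 0)) (le_trans (ler_normD _ _)) //.
by rewrite lerD // (le_trans zij).
Qed.

Lemma backward_recovers : outputs_in (backward_step Phi y) k (m - k)
  (fun D => supp x \subset D /\ (#|supp x| = k -> D = supp x)).
Proof. exact: elimination_outputs_in (fun A _ => @backward_total A) @backward_sound. Qed.

Lemma lace_recovers : outputs_in (lace_step Phi y) k (m - k)
  (fun D => supp x \subset D /\ (#|supp x| = k -> D = supp x)).
Proof. exact: elimination_outputs_in (fun A _ => @lace_total A) @lace_sound. Qed.

End Recovery.

Local Close Scope sesquilinear_scope.

(* The returned set has k elements (when k <= m), so it can equal supp x only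
   if #|supp x| = k; for sparser x the support is contained in it. *)
Theorem theorem3p1 (R : realType) (n m k : nat)
    (Phi : 'M[R[i]]_(n, m)) (x : 'cV[R[i]]_m) (e : 'cV[R[i]]_n) :
  \rank Phi = m ->
  (#|supp x| <= k)%N ->
  (supp x != set0 ->
   l2norm e < sigma_min Phi / 2 * seq_min [seq `|x i 0| | i in supp x]) ->
  let y := Phi *m x + e in
  let recovered (D : {set 'I_m}) :=
    supp x \subset D /\ (#|supp x| = k -> D = supp x) in
  outputs_in (backward_step Phi y) k (m - k) recovered /\
  outputs_in (lace_step Phi y) k (m - k) recovered.
Proof.
by move=> rkPhi xk noise; split; [apply: backward_recovers | apply: lace_recovers].
Qed.
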